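(* Let $p$ be a prime with $p \equiv 3 \pmod{4}$ such that $2$ is a primitive root modulo $p$. Suppose that $p$ satisfies the following condition: for every integer $\delta$ with $1 \leq \delta < p$, there exist an odd prime power $q \equiv 1 \pmod{p}$ and a positive integer $d \equiv \delta \pmod{p}$ such that $r = \frac{q^d-1}{q-1}$ is a prime power with $r \equiv 1 \pmod{4}$. Then, for all but finitely many positive integers $n$, an $MH(n,p)$ exists if $n$ is not an odd quadratic nonresidue of $p$ (that is, unless $n$ is odd and is a quadratic nonresidue modulo $p$).
   Context: For positive integers $n, m$, an $MH(n,m)$ (an $m$-modular Hadamard matrix of size $n$) is an $n \times n$ matrix $H$ with all entries in $\{+1,-1\}$ such that $HH^\top \equiv nI \pmod{m}$ (entrywise), where $I$ is the identity matrix. A prime power is an integer of the form $\ell^e$ with $\ell$ prime and $e \geq 1$ (so $1$ is not a prime power). A quadratic nonresidue modulo $p$ is an integer not congruent to any square modulo $p$; in particular multiples of $p$ are not nonresidues. *)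

(* Defs.v *)
From mathcomp Require Import all_boot all_order all_algebra.

Set Implicit Arguments.
Unset Strict Implicit.
Unset Printing Implicit Defensive.

Import GRing.Theory.

Local Open Scope ring_scope.

Definition modular_hadamard (n m : nat) (H : 'M[int]_n) : Prop :=
  (forall i j, H i j = 1 \/ H i j = -1) /\
  (forall i j, ((H *m H^T) i j = (n%:Z)%:M i j %[mod m%:Z])%Z).

Definition MH_exists (n m : nat) : Prop :=
  exists H : 'M[int]_n, modular_hadamard m H.

Definition prime_power (q : nat) : Prop :=
  exists l e : nat, [/\ prime l, (0 < e)%N & q = (l ^ e)%N].

Definition quadratic_nonresidue (p : nat) (a : int) : Prop :=
  forall x : int, ~ (a = x ^+ 2 %[mod p%:Z])%Z.

(* ['F_p] is the field of integers modulo p because p is prime wherever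
   this is used. *)
Definition primitive_root_mod (p a : nat) : Prop :=
  (p.-1).-primitive_root (a%:R : 'F_p).

(* Main.v *)
(* The matrix has 2 x 2 blocks: on the diagonal [A1] of size [n1 = 4 ^ i * a], a
   Kronecker product of matrices [J - 2I], and [A2] of size [n2], the +-1
   incidence matrix of the points and hyperplanes of a projective space over the
   field with [r] elements; off the diagonal two blocks [J]. Take [m] with [r ^
   m = 1] modulo [p], where [m] is the dimension of the vector space. Then [n2 =
   (r ^ m - 1) / (r - 1) = 0], and the rows of [A2] have sum [2 / r] and
   pairwise products [- (2 / r) ^ 2] modulo [p]; so the block matrix works when
   [n = n1 = (2 / r) ^ 2] modulo [p], up to replacing [A2] by [- A2].

   As 2 is a primitive root, each nonzero square is [4 ^ (i + 1)] for some [i];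
   as -1 is a nonresidue, one of the two [delta] with [(2 / delta) ^ 2 = 4 ^ (i
   + 1)] has odd order, so with [r = delta] modulo [p] the exponent [m] runs
   over the multiples of an odd number (the case [delta = 1], where [n2] does
   not vanish, is [n = 4]: take [J - 2I]). Since [r = 1] modulo 4, the resulting
   sizes [n2] then cover all classes modulo [4 ^ i], so that [n - n2] is a
   possible [n1] for every large [n] in the class of [4 ^ (i + 1)]. Finally 2 is
   a nonresidue, and an even nonresidue [n] is reached by doubling [n / 2]. *)
Require Import Defs.
From mathcomp Require Import all_boot all_order all_algebra.
From mathcomp Require Import all_field zify ring.

Set Implicit Arguments.
Unset Strict Implicit.
Unset Printing Implicit Defensive.

Import GRing.Theory.

(** * Geometric sums modulo powers of 2 *)

Definition geom (r g : nat) : nat := (\sum_(t < g) r ^ t)%N.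

Lemma geomD r g h : geom r (g + h) = (geom r g + r ^ g * geom r h)%N.
Proof.
rewrite /geom big_split_ord /= big_distrr; congr addn.
by apply: eq_bigr => t _; rewrite expnD.
Qed.

Lemma expn_mod4 r t : r = 1 %[mod 4] -> r ^ t = 1 %[mod 4].
Proof. by move=> r1; rewrite -modnXm r1 modnXm exp1n. Qed.

Lemma odd_geom r g : odd r -> odd (geom r g) = odd g.
Proof.
move=> or; elim: g => [|g IH]; first by rewrite /geom big_ord0.
by rewrite -addn1 geomD !oddD IH oddM oddX or orbT /geom big_ord1.
Qed.

(** Each factor 2 of [geom r g] comes from one of [g]: [geom r (h + h)] is [(1 + r ^ h) * geom r h],
    and [1 + r ^ h] is twice an odd number because [r] is 1 modulo 4. *)
Lemma dvdn_geom r k g : r = 1 %[mod 4] -> 2 ^ k %| geom r g -> 2 ^ k %| g.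
Proof.
move=> r1; elim: k g => [|k IH] g; first by rewrite dvd1n.
have or : odd r by rewrite -(odd_mod r (erefl : odd 4 = false)) r1.
have [og dg|eg] := boolP (odd g).
  have : ~~ odd (geom r g).
    by rewrite -dvdn2; apply: dvdn_trans dg; rewrite expnS dvdn_mulr.
  by rewrite odd_geom // og.
have {eg} -> : g = (g./2 + g./2)%N by rewrite addnn even_halfK.
set h := g./2; rewrite geomD -{1}[geom r h]mul1n -mulnDl => dg.
have [w E] : exists w, (1 + r ^ h = 2 * w.*2.+1)%N.
  exists ((r ^ h) %/ 4); have := divn_eq (r ^ h) 4.
  by rewrite (expn_mod4 h r1); lia.
move: dg; rewrite E expnS -mulnA dvdn_pmul2l // Gauss_dvdr; last first.
  by rewrite coprimeXl // coprime2n /= odd_double.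
by move/IH => dh; rewrite addnn -mul2n dvdn_pmul2l.
Qed.

(* Hull-Dobell: [x -> r x + 1] has full period modulo [2 ^ k]. *)
Lemma geom_onto r o k c : r = 1 %[mod 4] -> odd o ->
  exists h, (h <= 2 ^ k)%N && (geom r (h * o) == c %[mod 2 ^ k]).
Proof.
move=> r1 oo; have M0 : (0 < 2 ^ k)%N by rewrite expn_gt0.
have or : odd r by rewrite -(odd_mod r (erefl : odd 4 = false)) r1.
(* An injective self-map of a finite set is onto. Here the values at [h' <= h] differ by a power of
   the odd [r] times [geom r ((h - h') * o)]; if they agree, [2 ^ k] divides [h - h'], which is less
   than [2 ^ k]. *)
pose f (h : 'I_(2 ^ k)) : 'I_(2 ^ k) :=
  Ordinal (ltn_pmod (geom r (h.+1 * o)) M0).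
have inj : injective f.
  have le (h h' : 'I_(2 ^ k)) : (h' <= h)%N -> f h = f h' -> h = h'.
    move=> lh /(congr1 val) /= /eqP.
    have -> : (h.+1 * o = h'.+1 * o + (h - h') * o)%N.
      by rewrite -mulnDl addSn subnKC.
    rewrite geomD eqn_mod_dvd ?leq_addr // addKn Gauss_dvdr; last first.
      by rewrite coprimeXl // coprimeXr // coprime2n.
    move/(dvdn_geom r1); rewrite Gauss_dvdl; last by rewrite coprimeXl // coprime2n.
    have [d0 _|d0 /(dvdn_leq d0)] := posnP (h - h').
      by apply/val_inj/eqP; rewrite eqn_leq lh -subn_eq0 d0 eqxx.
    by rewrite leqNgt (leq_ltn_trans (leq_subr _ _) (ltn_ord h)).
  by move=> h h' E; have [/le->|/ltnW/le <-] := leqP h' h.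
have /codomP[h /(congr1 val) /= E] := injF_onto inj (Ordinal (ltn_pmod c M0)).
by exists h.+1; rewrite ltn_ord -E eqxx.
Qed.

(** * Sign matrices with values in a ring *)

Local Open Scope ring_scope.

(** A sign matrix is encoded as a boolean function, with [true] for the entry -1. Its rows and
    columns are indexed by any finite type, so products and sums of types serve as index sets. *)
Definition row_sum (R : pzRingType) (T : finType) (H : T -> T -> bool) (x : T) : R :=
  \sum_z (-1) ^+ H x z.

Definition row_dot (R : pzRingType) (T : finType) (H : T -> T -> bool) (x y : T) : R :=
  \sum_z (-1) ^+ H x z * (-1) ^+ H y z.

(** The diagonal needs no condition: a row of signs has product [#|T|] with itself. *)
Definition orthogonal_rows (R : pzRingType) (T : finType) (H : T -> T -> bool) :=
  forall x y, x != y -> row_dot R H x y = 0.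

Lemma MH_exists_orthogonal_rows p (T : finType) (H : T -> T -> bool) :
  prime p -> orthogonal_rows 'F_p H -> MH_exists #|T| p.
Proof.
move=> pp oH.
exists (\matrix_(i, j) (-1) ^+ H (enum_val i) (enum_val j)); split.
  by move=> i j; rewrite mxE; case: (H _ _); [right | left].
move=> i j; apply/eqP; rewrite eqz_mod_dvd (dvdz_pcharf (pchar_Fp pp)).
rewrite rmorphB /= subr_eq0; apply/eqP.
rewrite !mxE rmorph_sum /=.
have -> : \sum_(k < #|T|) (((\matrix_(i, j) (-1) ^+ H (enum_val i) (enum_val j)) i k *
    (\matrix_(i, j) (-1) ^+ H (enum_val i) (enum_val j))^T k j)%:~R : 'F_p) =
    row_dot 'F_p H (enum_val i) (enum_val j).
  rewrite /row_dot (reindex _ (onW_bij predT (@enum_val_bij T))) /=.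
  by apply: eq_bigr => k _; rewrite !mxE rmorphM /= !rmorphXn /= rmorphN1.
have [->|nij] := eqVneq i j; last by rewrite oH ?(inj_eq enum_val_inj).
rewrite /row_dot (eq_bigr (fun=> 1)) ?sumr_const ?mulr1n //.
by move=> z _; rewrite -expr2 sqrr_sign.
Qed.

(** * Simplex, Kronecker and block constructions *)

Section Constructions.

Variable R : comPzRingType.
Implicit Types T : finType.

Definition simplex_rows T (x y : T) : bool := x == y.

Lemma sum_sign_eq T (x : T) : \sum_z (-1) ^+ (x == z) = (#|T|%:R - 2 : R).
Proof.
rewrite (bigD1 x) //= eqxx expr1 (eq_bigr (fun=> 1)).
  rewrite sumr_const cardC1 -[#|T|](prednK (_ : 0 < #|T|)%N); last first.
    by apply/card_gt0P; exists x.
  by rewrite -natr1 /=; ring.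
by move=> z /negbTE; rewrite eq_sym => ->.
Qed.

Lemma row_sum_simplex T (x : T) : row_sum R (@simplex_rows T) x = #|T|%:R - 2.
Proof. exact: sum_sign_eq. Qed.

Lemma row_dot_simplex T (x y : T) : x != y ->
  row_dot R (@simplex_rows T) x y = #|T|%:R - 4.
Proof.
move=> nxy; rewrite /row_dot /simplex_rows.
(* At each [z] at least one of the two signs is 1, so [(s - 1) * (t - 1) = 0]. *)
have E z : (-1) ^+ (x == z) * (-1) ^+ (y == z) =
  (-1) ^+ (x == z) + (-1) ^+ (y == z) - 1 :> R.
  have [<-|_] := eqVneq x z; first by rewrite eq_sym (negbTE nxy); ring.
  by rewrite expr0; ring.
rewrite (eq_bigr _ (fun z _ => E z)) sumrB big_split /= !sum_sign_eq sumr_const.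
ring.
Qed.

Definition tensor_rows T1 T2 (H1 : T1 -> T1 -> bool) (H2 : T2 -> T2 -> bool)
  (x y : T1 * T2) : bool := H1 x.1 y.1 (+) H2 x.2 y.2.

Lemma row_sum_tensor T1 T2 (H1 : T1 -> T1 -> bool) (H2 : T2 -> T2 -> bool) x :
  row_sum R (tensor_rows H1 H2) x = row_sum R H1 x.1 * row_sum R H2 x.2.
Proof.
rewrite /row_sum mulr_suml (eq_bigr _ (fun i _ => mulr_sumr _ _ _ _)) pair_big.
by apply: eq_bigr => z _; rewrite /tensor_rows signr_addb.
Qed.

Lemma row_dot_tensor T1 T2 (H1 : T1 -> T1 -> bool) (H2 : T2 -> T2 -> bool) x y :
  row_dot R (tensor_rows H1 H2) x y =
    row_dot R H1 x.1 y.1 * row_dot R H2 x.2 y.2.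
Proof.
rewrite /row_dot mulr_suml (eq_bigr _ (fun i _ => mulr_sumr _ _ _ _)) pair_big.
by apply: eq_bigr => z _; rewrite /tensor_rows !signr_addb mulrACA.
Qed.

Lemma orthogonal_rows_tensor T1 T2 (H1 : T1 -> T1 -> bool)
    (H2 : T2 -> T2 -> bool) :
  orthogonal_rows R H1 -> orthogonal_rows R H2 ->
  orthogonal_rows R (tensor_rows H1 H2).
Proof.
move=> o1 o2 [x1 x2] [y1 y2]; rewrite row_dot_tensor xpair_eqE negb_and /=.
by case/orP => [/o1|/o2] ->; rewrite ?mul0r ?mulr0.
Qed.

(** Under the encoding, [andb] is the Hadamard matrix of size 2. *)
Lemma orthogonal_rows_andb : orthogonal_rows R andb.
Proof.
move=> x y; rewrite /row_dot big_bool /= !andbT !andbF.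
by case: x; case: y => //= _; ring.
Qed.

Definition glue_rows T1 T2 (H1 : T1 -> T1 -> bool) (H2 : T2 -> T2 -> bool)
  (x y : T1 + T2) : bool :=
  match x, y with
  | inl x, inl y => H1 x y
  | inr x, inr y => H2 x y
  | _, _ => false
  end.

(** The blocks of ones add [#|T2| = 0] to the product of two upper rows and [#|T1|] to that of two
    lower rows. An upper and a lower row have as product the sum of their row sums, [s - s]. *)
Lemma orthogonal_rows_glue T1 T2 (H1 : T1 -> T1 -> bool)
    (H2 : T2 -> T2 -> bool) (s : R) :
  orthogonal_rows R H1 -> (forall x, row_sum R H1 x = s) ->
  (forall x y, x != y -> row_dot R H2 x y = - #|T1|%:R) ->
  (forall x, row_sum R H2 x = - s) -> #|T2|%:R = 0 :> R ->
  orthogonal_rows R (glue_rows H1 H2).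
Proof.
move=> o1 s1 o2 s2 c2 [] x [] y; rewrite /row_dot big_sumType /= => nxy.
- rewrite -[X in X + _]/(row_dot R H1 x y) o1 //.
  by rewrite (eq_bigr (fun=> 1)) ?sumr_const ?add0r // => z _; rewrite mulr1.
- under eq_bigr do rewrite mulr1; under [X in _ + X]eq_bigr do rewrite mul1r.
  by rewrite -/(row_sum R H1 x) -/(row_sum R H2 y) s1 s2 subrr.
- under eq_bigr do rewrite mul1r; under [X in _ + X]eq_bigr do rewrite mulr1.
  by rewrite -/(row_sum R H1 y) -/(row_sum R H2 x) s1 s2 subrr.
- rewrite -[X in _ + X]/(row_dot R H2 x y) o2 //.
  rewrite (eq_bigr (fun=> 1)) ?sumr_const ?subrr // => z _; exact: mulr1.
Qed.

Lemma row_sum_compl T (H : T -> T -> bool) x :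
  row_sum R (fun x y => ~~ H x y) x = - row_sum R H x.
Proof.
by rewrite /row_sum -sumrN; apply: eq_bigr => z _; rewrite signrN.
Qed.

Lemma row_dot_compl T (H : T -> T -> bool) x y :
  row_dot R (fun x y => ~~ H x y) x y = row_dot R H x y.
Proof. by apply: eq_bigr => z _; rewrite !signrN mulrNN. Qed.

(* Kronecker power of the 4 x 4 Hadamard matrix [J - 2I] times a matrix
   [J - 2I] of arbitrary size [a = 4] in [R]. *)
Lemma regular_orthogonal_rows (i a : nat) : a%:R = 4 :> R ->
  exists (T : finType) (H : T -> T -> bool),
    [/\ #|T| = (4 ^ i * a)%N, orthogonal_rows R H &
        forall x, row_sum R H x = 2 ^+ i.+1].
Proof.
move=> a4; elim: i => [|i [T [H [cT oH sH]]]].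
  exists 'I_a, (@simplex_rows _); split; first by rewrite card_ord mul1n.
    by move=> x y nxy; rewrite row_dot_simplex // card_ord a4 subrr.
  by move=> x; rewrite row_sum_simplex card_ord a4; ring.
exists (('I_4 * T)%type : finType), (tensor_rows (@simplex_rows _) H); split.
- by rewrite card_prod card_ord cT expnS mulnA.
- apply: orthogonal_rows_tensor => // x y nxy.
  by rewrite row_dot_simplex // card_ord subrr.
- by move=> x; rewrite row_sum_tensor row_sum_simplex card_ord sH [RHS]exprS; ring.
Qed.

End Constructions.

(** * Points and hyperplanes of a projective space *)

Lemma card_row_full_ker (F : finFieldType) m k (L : 'M[F]_(m, k)) :
  row_full L -> (#|F| ^ k * #|[set z : 'rV_m | z *m L == 0%R]|)%N = (#|F| ^ m)%N.
Proof.
case/row_fullP => A AL.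
(* Every fibre of [z *m L] is a translate of the kernel, by the preimage [b *m A] of [b]. *)
have fib (b : 'rV_k) : #|[set z : 'rV_m | z *m L == b]| =
    #|[set z : 'rV_m | z *m L == 0]|.
  rewrite -[RHS](card_imset _ (addrI (b *m A))); apply: eq_card => z.
  rewrite inE; apply/eqP/imsetP => [zb | [w]].
    by exists (z - b *m A); rewrite ?inE ?mulmxBl -?mulmxA ?AL ?mulmx1 ?zb;
      rewrite ?subrr // addrC subrK.
  by rewrite inE => /eqP w0 ->; rewrite mulmxDl w0 -mulmxA AL mulmx1 addr0.
have := card_mx F 1 m; rewrite mul1n => <-.
have := card_mx F 1 k; rewrite mul1n => <-.
rewrite -[RHS]sum1_card (partition_big (fun z : 'rV_m => z *m L) xpredT) //=.
rewrite -sum_nat_const; apply: eq_bigr => b _.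
by rewrite -(fib b) -sum1_card; apply: eq_bigl => z; rewrite inE.
Qed.

Section ProjectiveSpace.

Variables (F : finFieldType) (m : nat).
Implicit Types x y z : 'rV[F]_m.

(** Canonical vector on the line of [x]: [pick] depends only on the set of nonzero multiples of [x].
    The default 0 is never reached, as [x] itself is a candidate. *)
Definition line_rep x : 'rV[F]_m :=
  odflt 0 [pick y | [exists c, (c != 0) && (y == c *: x)]].

Lemma line_repP x : exists2 c, c != 0 & line_rep x = c *: x.
Proof.
rewrite /line_rep; case: pickP => [y /existsP[c /andP[c0 /eqP ->]] | /(_ x)].
  by exists c.
by case/existsP; exists 1; rewrite oner_eq0 scale1r eqxx.
Qed.

Lemma line_repZ c x : c != 0 -> line_rep (c *: x) = line_rep x.
Proof.
move=> c0; rewrite /line_rep; congr odflt; apply: eq_pick => y.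
apply/existsP/existsP => -[e /andP[e0 /eqP ->]].
  by exists (e * c); rewrite mulf_neq0 // scalerA eqxx.
by exists (e / c); rewrite mulf_neq0 ?invr_eq0 // scalerA divfK ?eqxx.
Qed.

Definition proj_points : {set 'rV[F]_m} :=
  [set x | (x != 0) && (line_rep x == x)].

Lemma proj_pointsP x y c :
  x \in proj_points -> y \in proj_points -> c != 0 -> x = c *: y -> x = y.
Proof.
rewrite !inE => /andP[_ /eqP xx] /andP[_ /eqP yy] c0 E.
by rewrite -xx E line_repZ.
Qed.

Lemma sum_proj_points (V : nmodType) (f : 'rV[F]_m -> V) :
  (forall c x, c != 0 -> f (c *: x) = f x) ->
  \sum_(x | x != 0) f x = (\sum_(x in proj_points) f x) *+ #|F|.-1.
Proof.
move=> fZ; rewrite (partition_big line_rep (mem proj_points)) /=; last first.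
  move=> x x0; have [c c0 E] := line_repP x.
  by rewrite inE E line_repZ // E scaler_eq0 negb_or c0 x0 eqxx.
rewrite -sumrMnl; apply: eq_bigr => y; rewrite inE => /andP[y0 /eqP yy].
have [j yj] : exists j, y 0 j != 0 by apply/rV0Pn.
(* The nonzero vectors on the line of [y] are the [c *: y] with [c] nonzero; the coordinate [j]
   recovers [c]. *)
rewrite (reindex_onto (fun c => c *: y) (fun z => z 0 j / y 0 j)) /=.
  rewrite (eq_bigl (predC1 0)) => [|c].
    by rewrite (eq_bigr (fun=> f y)) ?sumr_const ?cardC1 // => c /fZ.
  rewrite !inE mxE mulfK // eqxx andbT scaler_eq0 negb_or y0 andbT.
  by have [//|c0] := eqVneq c 0; rewrite line_repZ // yy eqxx.
move=> z /andP[z0 /eqP zy]; have [c c0] := line_repP z; rewrite zy => yE.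
move: yj; rewrite yE mxE mulf_eq0 negb_or => /andP[_ zj].
have E : z 0 j / (c * z 0 j) * c = 1 by field; rewrite c0 zj.
by rewrite scalerA E scale1r.
Qed.

Lemma card_proj_points : #|proj_points| = (\sum_(t < m) #|F| ^ t)%N.
Proof.
have F1 : (0 < #|F|.-1)%N by have := finNzRing_gt1 F; case: #|F| => [|[]].
apply/eqP; rewrite -(eqn_pmul2l F1) -predn_exp; apply/eqP.
have := @sum_proj_points nat (fun=> 1%N) (fun _ _ _ => erefl).
rewrite (sumr_const (predC1 (0 : 'rV[F]_m))) sumr_const cardC1 card_mx mul1n.
by rewrite -mulrnA !natn mulnC => ->.
Qed.

(** A hyperplane is indexed by its normal vector, so points index both rows and columns; incidence
    gives the entry -1. *)
Definition hyperplane_rows (i j : 'I_#|proj_points|) : bool :=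
  enum_val j *m (enum_val i)^T == 0.

Section Counts.

Variable K : fieldType.
Local Notation r := (#|F|%:R : K).
Hypotheses (r1 : r != 1) (rm : r ^+ m = 1).

Let r_neq0 x : x \in proj_points -> r != 0.
Proof.
rewrite inE => /andP[/rV0Pn[j _] _]; apply: contra_eq_neq rm => ->.
by rewrite expr0n -leqn0 leqNgt (leq_ltn_trans _ (ltn_ord j)) //= eq_sym oner_eq0.
Qed.

(** Reduces sums over points to sums over all vectors, where kernels can be counted. *)
Let sum_nonzero (f : 'rV[F]_m -> K) :
  (forall c x, c != 0 -> f (c *: x) = f x) ->
  \sum_x f x - f 0 = (r - 1) * \sum_(x in proj_points) f x.
Proof.
move=> fZ; rewrite (bigD1 0) //= [f 0 + _]addrC addrK.
rewrite sum_proj_points // -[LHS]mulr_natl.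
congr (_ * _); have := finNzRing_gt1 F; case: #|F| => // k _; rewrite -natr1 addrK //.
Qed.

Let sum_bool (b : 'rV[F]_m -> bool) : \sum_x (b x)%:R = #|[set x | b x]|%:R :> K.
Proof.
rewrite -sum1_card natr_sum [RHS]big_mkcond; apply: eq_bigr => x _; rewrite inE.
by case: (b x).
Qed.

Let sign_bool (b : bool) : (-1) ^+ b = 1 - 2 * b%:R :> K.
Proof. by case: b; rewrite ?expr1 ?expr0 /=; ring. Qed.

Let card_ker k (L : 'M[F]_(m, k)) : row_full L ->
  r ^+ k * #|[set z : 'rV_m | z *m L == 0%R]|%:R = 1.
Proof. by move/card_row_full_ker; rewrite -natrX -natrM => ->; rewrite natrX. Qed.

Let sum_one : \sum_(x : 'rV[F]_m) (1 : K) = 1.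
Proof. by rewrite sumr_const card_mx mul1n natrX. Qed.

Let point_neq0 (i : 'I_#|proj_points|) : (enum_val i : 'rV[F]_m) != 0.
Proof. by have := enum_valP i; rewrite inE => /andP[]. Qed.

Let sign_mulmxZ k (L : 'M[F]_(m, k)) c (z : 'rV_m) : c != 0 ->
  (-1) ^+ (c *: z *m L == 0) = (-1) ^+ (z *m L == 0) :> K.
Proof. by move=> c0; rewrite -scalemxAl scaler_eq0 (negbTE c0). Qed.

(** Since [r ^ m = 1], the whole space counts as 1 and a hyperplane as [1 / r]. Over all vectors the
    signs add up to [1 - 2 / r]; removing the sign -1 of the zero vector leaves
    [(r - 1) * (2 / r)]. *)
Lemma row_sum_hyperplane i : row_sum K hyperplane_rows i = 2 / r.
Proof.
set x : 'rV[F]_m := enum_val i.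
have r0 : r != 0 := r_neq0 (enum_valP i).
have := @card_ker 1 x^T; rewrite /row_full mxrank_tr rank_rV point_neq0 expr1.
set N := (#|[set z | z *m x^T == 0]|%:R) => /(_ isT) rN.
have := sum_nonzero (sign_mulmxZ x^T).
rewrite (@big_enum_val _ _ _ _ (mem proj_points))
  -/(row_sum K hyperplane_rows i) mul0mx eqxx expr1.
under eq_bigr do rewrite sign_bool.
rewrite sumrB sum_one -mulr_sumr sum_bool -/N => E.
have r1' : r - 1 != 0 by rewrite subr_eq0.
apply: (mulfI r1'); rewrite -E.
have -> : N = r^-1 by apply: (mulfI r0); rewrite rN divff.
by field.
Qed.

(** The same count, with two distinct hyperplanes meeting in codimension 2, thus in [1 / r ^ 2]
    vectors: [1 - 4 / r + 4 / r ^ 2], less 1 for the zero vector, is [(r - 1)] times the claimed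
    value. *)
Lemma row_dot_hyperplane i j : i != j ->
  row_dot K hyperplane_rows i j = - (2 / r) ^+ 2.
Proof.
move=> nij; set x : 'rV[F]_m := enum_val i; set y : 'rV[F]_m := enum_val j.
have r0 : r != 0 := r_neq0 (enum_valP i).
have rk z : z != 0 -> row_full (z^T : 'cV[F]_m).
  by rewrite /row_full mxrank_tr rank_rV => ->.
have := card_ker (rk _ (point_neq0 i)); have := card_ker (rk _ (point_neq0 j)).
rewrite -/x -/y !expr1; set Ny := (#|[set z | z *m y^T == 0]|%:R) => rNy.
set Nx := (#|[set z | z *m x^T == 0]|%:R) => rNx.
(* A nontrivial relation [a *: x + b *: y = 0] would make the two points proportional, hence
   equal. *)
have full : row_full (row_mx x^T y^T).
  rewrite -tr_col_mx /row_full mxrank_tr; apply: inj_row_free => v.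
  rewrite -[v]hsubmxK mul_row_col => E.
  have := E; rewrite [lsubmx v]mx11_scalar [rsubmx v]mx11_scalar !mul_scalar_mx.
  set a := lsubmx v 0 0; set b := rsubmx v 0 0 => ab.
  have [a0|a0] := eqVneq a 0.
    move: ab; rewrite a0 scale0r add0r => /eqP; rewrite scaler_eq0.
    by rewrite (negbTE (point_neq0 j)) orbF => /eqP ->; rewrite raddf0 row_mx0.
  have [b0|b0] := eqVneq b 0.
    move: ab; rewrite b0 scale0r addr0 => /eqP; rewrite scaler_eq0.
    by rewrite (negbTE (point_neq0 i)) (negbTE a0).
  case/eqP: nij; apply/enum_val_inj.
  apply: (@proj_pointsP _ _ (- (b / a))); rewrite ?enum_valP //.
    by rewrite oppr_eq0 mulf_neq0 ?invr_eq0.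
  apply: (scalerI a0); rewrite scalerA mulrN mulrC divfK // scaleNr.
  by apply/eqP; rewrite -addr_eq0; apply/eqP.
have := card_ker full; set N := (#|[set z | z *m row_mx _ _ == 0]|%:R) => rN.
have fZ c z : c != 0 -> (-1) ^+ (c *: z *m x^T == 0) * (-1) ^+ (c *: z *m y^T == 0)
    = (-1) ^+ (z *m x^T == 0) * (-1) ^+ (z *m y^T == 0) :> K.
  by move=> c0; rewrite !sign_mulmxZ.
have := sum_nonzero fZ.
rewrite (@big_enum_val _ _ _ _ (mem proj_points))
  -/(row_dot K hyperplane_rows i j) !mul0mx !eqxx expr1.
have signM z : (-1) ^+ (z *m x^T == 0) * (-1) ^+ (z *m y^T == 0) =
   1 - 2 * (z *m x^T == 0)%:R - 2 * (z *m y^T == 0)%:R +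
   4 * (z *m row_mx x^T y^T == 0)%:R :> K.
  rewrite !sign_bool mul_mx_row row_mx_eq0.
  by case: eqP => _; case: eqP => _ /=; ring.
under eq_bigr do rewrite signM.
rewrite big_split /= !sumrB sum_one -!mulr_sumr !sum_bool -/N -/Nx -/Ny => E.
have r1' : r - 1 != 0 by rewrite subr_eq0.
apply: (mulfI r1'); rewrite -E.
have -> : Nx = r^-1 by apply: (mulfI r0); rewrite rNx divff.
have -> : Ny = r^-1 by apply: (mulfI r0); rewrite rNy divff.
have -> : N = (r ^+ 2)^-1.
  by apply: (@mulfI _ (r ^+ 2)); rewrite ?expf_neq0 // divff ?expf_neq0.
by field.
Qed.

End Counts.
End ProjectiveSpace.

(** * Sizes reached by the constructions *)

Definition has_orthogonal_rows (R : pzRingType) (n : nat) : Prop :=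
  exists (T : finType) (H : T -> T -> bool), #|T| = n /\ orthogonal_rows R H.

Lemma has_orthogonal_rows_geom (R : fieldType) (r i o : nat) :
  prime_power r -> (r = 1 %[mod 4])%N -> odd o -> 2 != 0 :> R ->
  r%:R ^+ o = 1 :> R -> r%:R != 1 :> R -> (2 / r%:R) ^+ 2 = 4 ^+ i.+1 :> R ->
  exists B, forall n, (B <= n)%N -> n%:R = 4 ^+ i.+1 :> R ->
    has_orthogonal_rows R n.
Proof.
move=> [l [e [pl e0 rE]]] r4 oo two_neq0 ro r1 rs.
have [F _ cF] := pPrimePowerField pl e0; rewrite -rE in cF.
have r0 : (0 < r)%N by rewrite rE expn_gt0 prime_gt0.
(* [2 ^ i.*2 * o] bounds the exponents [h * o] that [geom_onto] can return, so [n] exceeds the size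
   [v] of the projective block. *)
exists (geom r (2 ^ i.*2 * o)%N).+1 => n Bn nE.
have [h /andP[hle /eqP hn]] := geom_onto i.*2 n r4 oo.
have vn : (geom r (h * o) < n)%N.
  apply: leq_ltn_trans Bn.
  rewrite -[X in (_ <= geom r X)%N](subnKC (leq_mul hle (leqnn o))).
  by rewrite geomD leq_addr.
set m := (h * o)%N in hn vn; set v := geom r m in hn vn.
have four : (2 ^ i.*2 = 4 ^ i)%N by rewrite -mul2n expnM.
have [a aE] : exists a, (n = 4 ^ i * a + v)%N.
  have : (2 ^ i.*2 %| n - v)%N by rewrite -eqn_mod_dvd ?hn // ltnW.
  case/dvdnP => a E; exists a; rewrite -four mulnC -E subnK // ltnW //.
have rm : r%:R ^+ m = 1 :> R by rewrite /m mulnC exprM ro expr1n.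
have v0 : v%:R = 0 :> R.
  have r1' : r%:R - 1 != 0 :> R by rewrite subr_eq0.
  apply: (mulfI r1'); rewrite mulr0 /v /geom natr_sum.
  by under eq_bigr do rewrite natrX; rewrite -subrX1 rm subrr.
have four_neq0 : 4 != 0 :> R by rewrite -[4]/((2 * 2)%:R) natrM mulf_neq0.
have a4 : a%:R = 4 :> R.
  apply: (@mulfI _ (4 ^+ i)); rewrite ?expf_neq0 // -exprSr -nE aE.
  by rewrite natrD v0 addr0 natrM natrX.
have [T1 [H1 [c1 o1 s1]]] := regular_orthogonal_rows i a4.
pose T2 : finType := 'I_#|proj_points F m|.
have c2 : #|T2| = v by rewrite card_ord card_proj_points cF.
have T1E : #|T1|%:R = 4 ^+ i.+1 :> R.
  by rewrite c1 -nE aE natrD v0 addr0.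
have r1F : #|F|%:R != 1 :> R by rewrite cF.
have rmF : #|F|%:R ^+ m = 1 :> R by rewrite cF.
have [H2 d2 s2] : exists2 H2 : T2 -> T2 -> bool,
    (forall x y, x != y -> row_dot R H2 x y = - #|T1|%:R) &
    (forall x, row_sum R H2 x = - 2 ^+ i.+1).
  (* Gluing needs row sums [- 2 ^+ i.+1]; complementing flips the row sums and keeps the row
     products. *)
  have sq : (2 / r%:R == 2 ^+ i.+1 :> R) || (2 / r%:R == - 2 ^+ i.+1 :> R).
    by rewrite -eqf_sqr rs exprAC -(natrX _ 2 2).
  case/orP: sq => /eqP sq.
    exists (fun x y => ~~ hyperplane_rows x y) => [x y nxy | x].
      by rewrite row_dot_compl row_dot_hyperplane // cF rs T1E.
    by rewrite row_sum_compl row_sum_hyperplane // cF sq.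
  exists (@hyperplane_rows F m) => [x y nxy | x].
    by rewrite row_dot_hyperplane // cF rs T1E.
  by rewrite row_sum_hyperplane // cF sq.
exists ((T1 + T2)%type : finType), (glue_rows H1 H2); split.
  by rewrite card_sum c1 c2 -aE.
by apply: orthogonal_rows_glue s1 d2 s2 _ => //; rewrite c2.
Qed.

Lemma has_orthogonal_rows_simplex (R : comPzRingType) n :
  n%:R = 4 :> R -> has_orthogonal_rows R n.
Proof.
move=> n4; exists 'I_n, (@simplex_rows _); split; first exact: card_ord.
by move=> x y nxy; rewrite row_dot_simplex // card_ord n4 subrr.
Qed.

Lemma has_orthogonal_rows_const (R : pzRingType) n :
  n%:R = 0 :> R -> has_orthogonal_rows R n.
Proof.
move=> n0; exists 'I_n, (fun _ _ => false); split; first exact: card_ord.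
move=> x y _; rewrite /row_dot (eq_bigr (fun=> 1)) ?sumr_const ?card_ord //.
by move=> z _; rewrite mulr1.
Qed.

Lemma has_orthogonal_rows_double (R : comPzRingType) n :
  has_orthogonal_rows R n -> has_orthogonal_rows R n.*2.
Proof.
move=> [T [H [cT oH]]].
exists ((bool * T)%type : finType), (tensor_rows andb H); split.
  by rewrite card_prod card_bool cT mul2n.
by apply: orthogonal_rows_tensor => //; apply: orthogonal_rows_andb.
Qed.

(** * Residues modulo [p] *)

Lemma Fp_exp_pred p (x : 'F_p) : prime p -> x != 0 -> x ^+ p.-1 = 1.
Proof.
move=> p_prime x0; apply: (mulfI x0); rewrite mulr1 -exprS prednK ?prime_gt0 //.
by have := expf_card x; rewrite card_Fp.
Qed.

Lemma natr_repunit p q d : prime p -> (1 < q)%N -> (q = 1 %[mod p])%N ->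
  ((q ^ d - 1) %/ (q - 1))%:R = d%:R :> 'F_p.
Proof.
move=> p_prime q1 qp; rewrite !subn1 predn_exp mulKn ?natr_sum; last first.
  by case: q q1 {qp} => [|[]].
have q1F : q%:R = 1 :> 'F_p.
  rewrite -(GRing.natr_mod_pchar (pchar_Fp p_prime)) qp.
  by rewrite (GRing.natr_mod_pchar (pchar_Fp p_prime)).
by under eq_bigr do rewrite natrX q1F expr1n; rewrite sumr_const card_ord.
Qed.

Lemma has_orthogonal_rows_square p (s : 'F_p) :
  prime p -> (p = 3 %[mod 4])%N -> primitive_root_mod p 2 ->
  (forall delta : 'F_p, delta != 0 ->
     exists r, [/\ prime_power r, (r = 1 %[mod 4])%N & r%:R = delta]) ->
  s != 0 ->
  exists B, forall n, (B <= n)%N -> n%:R = s ^+ 2 -> has_orthogonal_rows 'F_p n.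
Proof.
move=> p_prime p_mod4 two_primitive p_cond s0; have [s4|ns4] := eqVneq (s ^+ 2) 4.
  by exists 0%N => n _ nE; apply: has_orthogonal_rows_simplex; rewrite nE.
have [i sE] : exists i, s = 2 ^+ i.+1.
  have [[[|i] /= _] ->] := prim_rootP two_primitive (Fp_exp_pred p_prime s0).
    (* The exponent must be positive, so 1 is written as [2 ^+ p.-1]. *)
    exists p.-2; rewrite expr0.
    have -> : p.-2.+1 = p.-1 by have := prime_gt1 p_prime; lia.
    by rewrite (prim_expr_order two_primitive).
  by exists i.
have two0 : 2 != 0 :> 'F_p.
  by apply: contraNneq s0; rewrite sE exprS => ->; rewrite mul0r.
pose o := p./2; have po : p.-1 = (o * 2)%N by lia.
have oo : odd o by lia.
(* Of [2 / s] and its negative, exactly one has [o]-th power 1, because [o] is odd. *)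
have [delta [d1 d2]] : exists delta : 'F_p, delta ^+ o = 1 /\ (2 / delta) ^+ 2 = s ^+ 2.
  have x0 : 2 / s != 0 by rewrite mulf_neq0 ?invr_eq0.
  have := Fp_exp_pred p_prime x0; rewrite po exprM => /eqP.
  rewrite sqrf_eq1 => /orP[] /eqP E.
    exists (2 / s); split => //; field; by rewrite s0 two0.
  exists (- (2 / s)); rewrite exprNn -signr_odd oo E mulrNN mulr1; split=> //.
  by field; rewrite s0 oppr_eq0 two0.
have delta0 : delta != 0.
  apply: contra_eq_neq d1 => ->; rewrite expr0n.
  by case: (o) oo => //= k _; rewrite eq_sym oner_eq0.
have delta1 : delta != 1.
  by apply: contraNneq ns4 => dE; rewrite -d2 dE divr1 -(natrX _ 2 2).
have [r [ppr r4 rE]] := p_cond _ delta0.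
have [|||B BP] := has_orthogonal_rows_geom (i := i) ppr r4 oo two0.
- by rewrite rE.
- by rewrite rE.
- by rewrite rE d2 sE exprAC -(natrX _ 2 2).
by exists B => n Bn nE; apply: BP; rewrite // nE sE exprAC -(natrX _ 2 2).
Qed.

Lemma exprn_even (R : pzSemiRingType) (x : R) k :
  ~~ odd k -> x ^+ k = (x ^+ k./2) ^+ 2.
Proof. by move=> ek; rewrite -exprM muln2 even_halfK. Qed.

Lemma has_orthogonal_rows_large p :
  prime p -> (p = 3 %[mod 4])%N -> primitive_root_mod p 2 ->
  (forall delta : 'F_p, delta != 0 ->
     exists r, [/\ prime_power r, (r = 1 %[mod 4])%N & r%:R = delta]) ->
  exists B, forall n, (B <= n)%N -> ~ (odd n /\ quadratic_nonresidue p n) ->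
    has_orthogonal_rows 'F_p n.
Proof.
move=> p_prime p_mod4 two_primitive p_cond.
have two0 : 2 != 0 :> 'F_p.
  rewrite -(dvdn_pcharf (pchar_Fp p_prime)) dvdn_prime2 //.
  by apply: contra_eqN p_mod4 => /eqP ->.
(* With [s != 0] placed under the existential, a bound is chosen for every [s] and the maximum over
   the finite field can be taken. *)
have bound (s : 'F_p) : exists b, s != 0 ->
    forall n, (b <= n)%N -> n%:R = s ^+ 2 -> has_orthogonal_rows 'F_p n.
  have [->|s0] := eqVneq s 0; first by exists 0%N.
  have [b bP] := has_orthogonal_rows_square p_prime p_mod4 two_primitive p_cond s0.
  by exists b.
have [b bP] := fin_all_exists bound.
pose B := (\max_s b s)%N.
have large n s : (B <= n)%N -> n%:R != 0 :> 'F_p -> n%:R = s ^+ 2 :> 'F_p ->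
    has_orthogonal_rows 'F_p n.
  move=> Bn n0 nE; apply: (bP s) (nE).
    by apply: contraNneq n0 => s0; rewrite nE s0 expr0n.
  exact: leq_trans (leq_bigmax s) Bn.
(* Doubled so that [n./2] is still at least [B] when an even nonresidue is halved. *)
exists B.*2 => n Bn res.
have [n0|n0] := eqVneq (n%:R : 'F_p) 0; first exact: has_orthogonal_rows_const.
have Bn1 : (B <= n)%N by apply: leq_trans Bn; rewrite -addnn leq_addr.
have [/existsP[s /eqP nE]|nsq] := boolP [exists s : 'F_p, n%:R == s ^+ 2].
  exact: large nE.
have [on|en] := boolP (odd n).
  case: res; split=> // x /eqP; rewrite eqz_mod_dvd (dvdz_pcharf (pchar_Fp p_prime)).
  rewrite rmorphB subr_eq0 rmorphXn /= => nE.
  by case/existsP: nsq; exists x%:~R.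
have nE : n = n./2.*2 by rewrite even_halfK.
rewrite nE; apply: has_orthogonal_rows_double.
have [[j /= _] nj] := prim_rootP two_primitive (Fp_exp_pred p_prime n0).
have oj : odd j.
  by apply: contraR nsq => ej; apply/existsP; exists (2 ^+ j./2); rewrite nj exprn_even.
(* [n] is an odd power of 2 modulo [p], so half of it is an even power, hence a square. *)
have hE : n./2%:R = (2 ^+ j.-1./2) ^+ 2 :> 'F_p.
  rewrite -exprn_even; last by case: (j) oj.
  by apply: (mulfI two0); rewrite -exprS prednK ?odd_gt0 // -nj -natrM mul2n -nE.
apply: large hE; first by rewrite -(half_double B) half_leq.
by apply: contraNneq n0 => h0; rewrite nE -mul2n natrM h0 mulr0.
Qed.

Local Close Scope ring_scope.

Theorem theorem5p4 (p : nat) (p_prime : prime p) (p_mod4 : p = 3 %[mod 4])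
    (two_primitive : primitive_root_mod p 2)
    (p_cond : forall delta : nat, 1 <= delta -> delta < p ->
       exists q d : nat,
         [/\ prime_power q, odd q & q = 1 %[mod p]] /\
         [/\ 0 < d & d = delta %[mod p]] /\
         [/\ prime_power ((q ^ d - 1) %/ (q - 1)) &
             (q ^ d - 1) %/ (q - 1) = 1 %[mod 4]]) :
  exists exceptions : seq nat, forall n : nat,
    0 < n -> n \notin exceptions ->
    ~ (odd n /\ quadratic_nonresidue p n) -> MH_exists n p.
Proof.
have [delta delta0|B BP] := has_orthogonal_rows_large p_prime p_mod4 two_primitive.
  (* A nonzero element of ['F_p] is an ordinal, and read as a natural number it lies in the range of
     [p_cond]. *)
  have [||q [d [[ppq oq qp] [[_ dE] [ppr r4]]]]] := p_cond delta.
  - by rewrite lt0n; apply: contra delta0 => /eqP E; apply/eqP/val_inj.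
  - by have := ltn_ord delta; rewrite {2}Fp_cast.
  have q1 : 1 < q.
    by have [l [e [pl e0 ->]]] := ppq; rewrite -(exp1n e) ltn_exp2r // prime_gt1.
  exists ((q ^ d - 1) %/ (q - 1)); split=> //.
  rewrite natr_repunit // -(GRing.natr_mod_pchar (pchar_Fp p_prime)) dE.
  by rewrite (GRing.natr_mod_pchar (pchar_Fp p_prime)) natr_Zp.
exists (iota 0 B) => n _; rewrite mem_iota /= add0n -leqNgt => Bn res.
have [T [H [<- oH]]] := BP n Bn res.
exact: MH_exists_orthogonal_rows oH.
Qed.
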